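(* Let $A$ and $B$ be two nontrivial linear subspaces of $\mathbb R^d$ (each $\neq\{0\}$ and $\neq\mathbb R^d$). Let $a_0=x_0\in A\cup B$ and, for $k=1,2,\ldots$, put $a_k:=(P_AP_B)^k(a_0)$ and $x_k:=\left(\frac{P_A+P_B}{2}\right)^k(x_0)$. Assume that $\|a_1-P_{A\cap B}(a_0)\|>0$. Then, for each $k=1,2,\ldots$, $$\|x_k-P_{A\cap B}(x_0)\|>\|a_k-P_{A\cap B}(a_0)\|>0,$$ and the rates of $Q$-linear convergence $$\lambda:=\lim_{k\to\infty}\frac{\|a_{k+1}-P_{A\cap B}(a_0)\|}{\|a_k-P_{A\cap B}(a_0)\|}=\max\Big\{\Lambda(a_0,P_BP_AP_B)\setminus\{0,1\}\Big\}$$ and $$\mu:=\lim_{k\to\infty}\frac{\|x_{k+1}-P_{A\cap B}(x_0)\|}{\|x_k-P_{A\cap B}(x_0)\|}=\max\Big\{\Lambda\big(x_0,\tfrac{P_A+P_B}{2}\big)\setminus\{0,1\}\Big\}$$ satisfy $$\mu=\tfrac12+\tfrac12\sqrt{\lambda}>\lambda.$$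
   Context: $\mathbb R^d$ is equipped with an arbitrary inner product $\langle\cdot,\cdot\rangle$ and the induced norm $\|\cdot\|$. For a subspace $M\subset\mathbb R^d$, $P_M$ denotes the orthogonal projection onto $M$. For a linear operator $T$ on $\mathbb R^d$, $\mathcal N(T)$ is its null space, $\lambda-T$ stands for $\lambda I-T$, $\Lambda(T):=\{\lambda\in\mathbb R:\mathcal N(\lambda-T)\neq\{0\}\}$ is the set of eigenvalues, and for $x\in\mathbb R^d$, $\Lambda(x,T):=\{\lambda\in\Lambda(T):P_{\mathcal N(\lambda-T)}(x)\neq0\}$. *)

(* Defs.v *)
From HB Require Import structures.
From mathcomp Require Import all_boot all_order all_algebra.
From mathcomp Require Import sesquilinear.
From mathcomp Require Import all_classical all_reals all_analysis.

Set Implicit Arguments.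
Unset Strict Implicit.
Unset Printing Implicit Defensive.

Import Order.TTheory GRing.Theory Num.Theory.
Import numFieldNormedType.Exports.

Local Open Scope classical_set_scope.
Local Open Scope ring_scope.

(* An inner product on R^d is a term [ip : {dot 'rV[R]_d for idfun}]: a
   bilinear, symmetric (the twist of the Hermitian structure is the identity)
   and positive definite form. *)

Section EuclideanSpace.
Context {R : realType} {d : nat}.
Variable ip : {dot 'rV[R]_d for idfun}.
Implicit Types (M : {vspace 'rV[R]_d}) (T : 'End('rV[R]_d)) (x y : 'rV[R]_d).

Definition ipnorm x : R := Num.sqrt (ip x x).

(* The projection onto [M] along its [ip]-orthogonal complement;
   [orth_projP] below characterizes it. *)
Definition orth_proj M : 'End('rV[R]_d) := daddv_pi M (orthov ip M).

Definition eigenvalues T : set R := [set l | passmx.leigenvalue T l].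

Definition eigenvalues_at x T : set R :=
  [set l | eigenvalues T l /\ orth_proj (passmx.leigenspace T l) x != 0].

Definition is_max (S : set R) (m : R) : Prop := S m /\ ubound S m.

Lemma orthov_disjoint M : (M :&: orthov ip M = 0)%VS.
Proof.
apply/eqP; rewrite -subv0; apply/subvP => x; rewrite memv_cap memv0.
case/andP => xM /mem_orthovP/(_ x xM) xx0.
by apply: contraT => /(@neq0_dnorm_gt0 _ _ _ ip) /=; rewrite xx0 ltxx.
Qed.

Lemma orthov_supplement M : (M + orthov ip M = fullv)%VS.
Proof.
have dim_bigcap (f : nat -> 'Hom('rV[R]_d, R^o)) r :
    (\dim {:'rV[R]_d} <= r + \dim (\bigcap_(i < r) lker (f i))%VS)%N.
  elim: r => [|r IH]; first by rewrite big_ord0.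
  rewrite big_ord_recr /=; apply: (leq_trans IH).
  rewrite addSnnS leq_add2l -(limg_ker_dim (f r) (\bigcap_(i < r) lker (f i))%VS).
  rewrite -[leqRHS]addn1 leq_add2l (leq_trans (dimvS (subvf _))) //.
  by rewrite dimvf /dim /=.
apply/eqP; rewrite eqEdim subvf /= dimv_disjoint_sum ?orthov_disjoint //.
exact: (dim_bigcap (fun i => linfun (applyr ip (vbasis M)`_i : _ -> R^o))).
Qed.

Lemma orth_projP M x y :
  y = orth_proj M x <-> y \in M /\ {in M, forall z, ip (x - y) z = 0}.
Proof.
have dis := orthov_disjoint M.
have xE : orth_proj M x + daddv_pi (orthov ip M) M x = x.
  by apply: daddv_pi_add => //; rewrite orthov_supplement memvf.
split=> [->|[yM /mem_orthovP xyM]].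
  split; first exact: memv_pi.
  by apply/mem_orthovP; rewrite -{1}xE addrC addKr memv_pi.
apply/eqP; rewrite -subr_eq0 -memv0 -dis memv_cap rpredB ?memv_pi //=.
have -> : y - orth_proj M x = daddv_pi (orthov ip M) M x - (x - y).
  have -> : daddv_pi (orthov ip M) M x = x - orth_proj M x.
    by rewrite -{2}xE [_ + daddv_pi _ _ _]addrC addrK.
  by rewrite opprB [RHS]addrC addrA subrK.
by rewrite rpredB ?memv_pi.
Qed.

End EuclideanSpace.

(* Main.v *)
Require Import Defs.
From mathcomp Require Import all_boot all_order all_algebra.
From mathcomp Require Import sesquilinear.
From mathcomp Require Import all_classical all_reals all_analysis.
From mathcomp Require Import complex zify ring lra.
Import Order.TTheory GRing.Theory Num.Theory.
Import numFieldNormedType.Exports.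
Local Open Scope classical_set_scope.
Local Open Scope ring_scope.

(** Subtracting [p], the projection of [x0] on [A :&: B], which every operator
    in sight fixes, reduces everything to [y = x0 - p].  Call [C] the one of
    the two subspaces that contains [x0], and [D] the other one; [y] lies in
    [C] and is orthogonal to [C :&: D].

    The operator [PC PD PC] is self-adjoint, so that [y] is a sum of pairwise
    orthogonal eigenvectors [u l] of it; they lie in [C], and
    [l * |u l|^2 = |PD (u l)|^2] gives [0 <= l < 1], the value 1 being
    excluded because its eigenvectors lie in [C :&: D], to which [y] is
    orthogonal ([principal_decomposition]).  The plane spanned by [u l] and
    [PD (u l)], which is a line when [l = 0], is stable under both projections:
    this is the decomposition of a pair of subspaces by its principal angles,
    of which the [l] are the squared cosines.  On such a plane both iterations
    are explicit.

    - [PB PA PB] multiplies [PB (u l)], which may vanish when [l = 0], by [l]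
      ([alternating_eigen]), and [|a_k - p|^2] is the sum of the
      [l^(2k-1) * |PB (u l)|^2] ([alternating_sqnorm]).
    - [(PA + PB) / 2] has on the plane the eigenvalues [(1 +- sqrt l) / 2]
      ([avg_eigenvectorP]), and [|x_k - p|^2] is the sum of the
      [(((1 + sqrt l) / 2)^(2k+1) + ((1 - sqrt l) / 2)^(2k+1)) * |u l|^2]
      ([avg_sqnorm]).

    The strict inequality holds term by term ([avg_eigenvalue_gt]): from
    [(1 + t) / 2 >= t] and [((1 + t) / 2)^2 >= t], with [t = sqrt l], the first
    power already dominates [l^(2k-1)], and the second one is positive.  Both
    squared norms being finite sums of geometric sequences, the ratios tend to
    the largest eigenvalues that occur ([power_sum_rate]), which are [lambda],
    the largest [l], and [(1 + sqrt lambda) / 2].  These are also the maxima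
    of the two spectra seen from [x0]: the orthogonal projection on an
    eigenspace extracts from a sum of eigenvectors those for that eigenvalue
    ([eigen_proj_of_eigen]), and the vector [p] only contributes the
    eigenvalue 1. *)

Set Implicit Arguments.
Unset Strict Implicit.
Unset Printing Implicit Defensive.

(** * Inner products and finite sums *)

Section InnerProduct.
Context {R : realType} {d : nat} (ip : {dot 'rV[R]_d for idfun}).
Implicit Types x y z : 'rV[R]_d.

Lemma ipC x y : ip x y = ip y x.
Proof. by rewrite hermC /= expr0 mul1r. Qed.

Lemma ipDl x y z : ip (x + y) z = ip x z + ip y z.
Proof. by rewrite linearDl. Qed.

Lemma ipDr x y z : ip x (y + z) = ip x y + ip x z.
Proof. by rewrite linearDr. Qed.

Lemma ipBl x y z : ip (x - y) z = ip x z - ip y z.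
Proof. by rewrite linearBl. Qed.

Lemma ipBr x y z : ip x (y - z) = ip x y - ip x z.
Proof. by rewrite linearBr. Qed.

Lemma ip0l x : ip 0 x = 0.
Proof. by rewrite linear0l. Qed.

Lemma ip0r x : ip x 0 = 0.
Proof. by rewrite linear0r. Qed.

Lemma ipZl c x y : ip (c *: x) y = c * ip x y.
Proof. by rewrite linearZl_LR. Qed.

Lemma ipZr c x y : ip x (c *: y) = c * ip x y.
Proof. by rewrite ipC ipZl ipC. Qed.

Lemma ip_gt0 x : (0 < ip x x) = (x != 0).
Proof.
have [->|x0] := eqVneq x 0; first by rewrite ip0l ltxx.
exact: (@neq0_dnorm_gt0 _ _ _ ip).
Qed.

Lemma ip_ge0 x : 0 <= ip x x.
Proof.
have [->|x0] := eqVneq x 0; first by rewrite ip0l.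
by rewrite ltW // ip_gt0.
Qed.

Lemma ip_eq0 x : ip x x = 0 -> x = 0.
Proof. by move=> xx; apply/eqP/negbNE; rewrite -ip_gt0 xx ltxx. Qed.

Lemma ip_suml (I : Type) (r : seq I) (w : I -> 'rV[R]_d) y :
  ip (\sum_(i <- r) w i) y = \sum_(i <- r) ip (w i) y.
Proof. by elim/big_rec2: _ => [|i u v _ <-]; rewrite ?ip0l ?ipDl. Qed.

Lemma ip_sum_orth (I : eqType) (s : seq I) (v w : I -> 'rV[R]_d) : uniq s ->
    {in s &, forall i j, i != j -> ip (v i) (w j) = 0} ->
  ip (\sum_(i <- s) v i) (\sum_(j <- s) w j) = \sum_(i <- s) ip (v i) (w i).
Proof.
move=> us orth; rewrite ip_suml big_seq [RHS]big_seq; apply: eq_bigr => i si.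
rewrite ipC ip_suml (bigD1_seq i) //= ipC big_seq_cond big1 ?addr0 //.
by move=> j /andP[sj ji]; rewrite ipC orth // eq_sym.
Qed.

End InnerProduct.

Lemma seq_max (R : realType) (s : seq R) : s != [::] ->
  exists2 m, m \in s & {in s, forall x, x <= m}.
Proof.
elim: s => // a [|b s] IH _.
  by exists a; rewrite ?mem_head // => x; rewrite inE => /eqP ->.
have [//|m ms mmax] := IH; have [am|ma] := leP a m.
  exists m; first by rewrite inE ms orbT.
  by move=> x; rewrite inE => /orP[/eqP ->|/mmax].
exists a; first exact: mem_head.
by move=> x; rewrite inE => /orP[/eqP ->//|/mmax xm]; apply: le_trans (ltW ma).
Qed.

(** * The spectral theorem *)

(** A complex root [a + i b] of [p] is either real or a root of the quadratic
    polynomial below; in the second case the remainder of [p] by this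
    polynomial has degree at most 1 and vanishes at a point that is not real,
    hence it is zero. *)
Lemma real_quadratic_factor (R : realType) (p : {poly R}) : (1 < size p)%N ->
  (exists a, ('X - a%:P) %| p) \/
  (exists a b, b != 0 /\ (('X - a%:P) ^+ 2 + (b ^+ 2)%:P) %| p).
Proof.
move=> sp.
have /closed_rootP[z] : size (map_poly (real_complex R) p) != 1.
  by rewrite size_map_poly; case: (size p) sp => [|[]].
case: z => a b; have [-> rz|bN0 rz] := eqVneq b 0.
  left; exists a; rewrite dvdp_XsubCl -(fmorph_root (real_complex R)).
  exact: rz.
right; exists a, b; split=> //.
set Q := _ + _; have sQ : size Q = 3%N.
  rewrite /Q size_polyDl size_exp_XsubC //.
  by rewrite (leq_ltn_trans (size_polyC_leq1 _)).
have sr : (size (p %% Q)%R <= 2)%N.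
  by rewrite -ltnS -sQ ltn_modp -size_poly_gt0 sQ.
have Qz : root (map_poly (real_complex R) Q) (a +i* b)%C.
  rewrite /Q rootE rmorphD rmorphXn /= map_polyXsubC map_polyC /= !hornerE.
  by rewrite -[a%:C%C]/(a +i* 0)%C; apply/eqP; congr (_ +i* _)%C => /=; ring.
have : root (map_poly (real_complex R) (p %% Q)) (a +i* b)%C.
  move: rz; rewrite {1}(divp_eq p Q) rmorphD rmorphM /= !rootE !hornerE.
  by move: Qz; rewrite rootE => /eqP ->; rewrite mulr0 add0r.
rewrite rootE (horner_coef_wide _ (n := 2)) ?size_map_poly //.
rewrite big_ord_recr big_ord1 /= !coef_map /= expr0 expr1 mulr1.
set r := p %% Q => /eqP[/=]; rewrite !(mul0r, subr0, addr0, add0r) => r0 /eqP.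
rewrite mulf_eq0 (negbTE bN0) orbF => /eqP r1.
rewrite /dvdp -/r; apply/eqP/polyP => -[|[|k]]; rewrite coef0.
- by move: r0; rewrite r1 mul0r addr0.
- exact: r1.
- by apply: (leq_sizeP _ _ sr).
Qed.

Definition self_adjoint {R V : Type} (f : V -> V -> R) (T : V -> V) :=
  forall x y, f (T x) y = f x (T y).

(** The eigenvalues, in the first components, may be repeated: this is what
    keeps the property stable under addition, hence fit for an induction. *)
Definition is_eigen_sum {R : realType} d (T : 'rV[R]_d -> 'rV[R]_d) v :=
  exists2 s : seq (R * 'rV[R]_d),
    v = \sum_(i <- s) i.2 & {in s, forall i, T i.2 = i.1 *: i.2}.

Section Horner.
Context {R : realType} {n : nat} (ip : {dot 'rV[R]_n.+1 for idfun}).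
Variable (M : 'M[R]_n.+1).
Hypothesis Msa : self_adjoint ip (mulmx^~ M).

Lemma horner_self_adjoint f : self_adjoint ip (mulmx^~ (horner_mx M f)).
Proof.
move=> x y; elim/poly_ind: f x y => [|f c IH] x y.
  by rewrite rmorph0 !mulmx0 ip0l ip0r.
rewrite rmorphD rmorphM /= horner_mx_X horner_mx_C !mulmxDr !mul_mx_scalar.
rewrite ipDl ipDr ipZl ipZr; congr (_ + _).
have fM : horner_mx M f * M = M * horner_mx M f.
  by rewrite -{2 3}(horner_mx_X M) -!rmorphM mulrC.
by rewrite {1}fM mulmxA IH (Msa x) -mulmxA.
Qed.

Lemma horner_eigen f l (w : 'rV[R]_n.+1) :
  w *m M = l *: w -> w *m horner_mx M f = f.[l] *: w.
Proof.
move=> Mw; elim/poly_ind: f => [|f c IH].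
  by rewrite rmorph0 mulmx0 horner0 scale0r.
rewrite rmorphD rmorphM /= horner_mx_X horner_mx_C mulmxDr mulmxA IH.
by rewrite -scalemxAl Mw mul_mx_scalar hornerMXaddC scalerA scalerDl.
Qed.

(** For a self-adjoint operator the kernel of [f (M)] does not grow with the
    multiplicity of the factor [f], since [|f (M) v|^2 = <f (M)^2 v, v>]:
    there are no generalized eigenvectors. *)
Lemma horner_ker2 f (v : 'rV[R]_n.+1) :
  v *m horner_mx M (f * f) = 0 -> v *m horner_mx M f = 0.
Proof.
rewrite rmorphM mulmxA => v0.
by apply: (@ip_eq0 _ _ ip); rewrite -horner_self_adjoint v0 ip0l.
Qed.

(** Descent along a factor [f] of a polynomial that annihilates [v].  If
    [f (M) v] is a sum of eigenvectors, dividing by [f.[l]] the ones on which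
    [f (M)] does not vanish gives a sum [t] of eigenvectors such that [v - t]
    is killed by [f (M)^2], hence by [f (M)]. *)
Lemma eigen_sum_step f (v : 'rV[R]_n.+1) :
    (forall u, u *m horner_mx M f = 0 -> is_eigen_sum (mulmx^~ M) u) ->
  is_eigen_sum (mulmx^~ M) (v *m horner_mx M f) ->
  is_eigen_sum (mulmx^~ M) v.
Proof.
move=> kf [s fv sE].
pose g (i : R * 'rV[R]_n.+1) : R * 'rV[R]_n.+1 := (i.1, f.[i.1]^-1 *: i.2).
pose t := [seq g i | i <- s & f.[i.1] != 0].
have tE : {in t, forall i, i.2 *m M = i.1 *: i.2}.
  move=> j jt; case: (mapP jt) => i; rewrite mem_filter => /andP[_ /sE iE] -> /=.
  by rewrite -scalemxAl iE !scalerA mulrC.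
have [|r rE rM] := kf (v - \sum_(i <- t) i.2).
  apply: horner_ker2; rewrite rmorphM mulmxA mulmxBl mulmx_suml fv big_map.
  rewrite big_filter (bigID (fun i => f.[i.1] != 0)) /= addrC.
  rewrite [X in _ - X]big_seq_cond [X in _ - X](eq_bigr snd); last first.
    move=> i /andP[si fi]; rewrite -scalemxAl (@horner_eigen _ i.1) ?sE //.
    by rewrite scalerA mulVf // scale1r.
  rewrite -big_seq_cond addrK mulmx_suml big_seq_cond big1 // => i /andP[/sE iE].
  by move=> /negPn/eqP fi; rewrite (@horner_eigen _ i.1) ?iE // fi scale0r.
exists (r ++ t); first by rewrite big_cat /= -rE subrK.
by move=> i; rewrite mem_cat => /orP[/rM|/tE].
Qed.

(** Induction on the degree of a polynomial [p] that annihilates [v], starting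
    from the characteristic polynomial.  A linear factor ['X - a] has
    eigenvectors as its kernel; a factor [('X - a)^2 + b^2] with [b != 0] is
    injective, as [<((M - a)^2 + b^2) u, u> = |(M - a) u|^2 + b^2 |u|^2]. *)
Lemma matrix_eigen_sum (v : 'rV[R]_n.+1) : is_eigen_sum (mulmx^~ M) v.
Proof.
have : v *m horner_mx M (char_poly M) = 0.
  by rewrite Cayley_Hamilton mulmx0.
have : char_poly M != 0 by rewrite monic_neq0 ?char_poly_monic.
move: (char_poly M) => p; have [k] := ubnP (size p).
elim: k p v => // k IH p v; rewrite ltnS => pk p0 vp.
have [p1|p1] := leqP (size p) 1.
  exists [::]; rewrite ?big_nil //; move: p0 vp.
  rewrite (size1_polyC p1) polyC_eq0 horner_mx_C mul_mx_scalar => p0 /eqP.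
  by rewrite scaler_eq0 (negbTE p0) => /eqP.
have step (f : {poly R}) : (1 < size f)%N -> f %| p ->
    (forall u, u *m horner_mx M f = 0 -> is_eigen_sum (mulmx^~ M) u) ->
    is_eigen_sum (mulmx^~ M) v.
  move=> f1 /dvdpP[q pE] kf; apply: (@eigen_sum_step f) => //.
  have q0 : q != 0 by apply: contraNneq p0 => q0; rewrite pE q0 mul0r.
  apply: (IH q _) => //.
    apply: leq_trans pk; rewrite pE size_mul // -?size_poly_gt0 //; last first.
      by apply: leq_trans f1.
    rewrite -size_poly_gt0 in q0.
    by case: (size f) f1 => [|[|m]] // _; rewrite !addnS /= ltnS leq_addr.
  by rewrite -mulmxA -[_ *m horner_mx M q]rmorphM mulrC -pE.
have [[a /step]|[a [b [b0 /step]]]] := real_quadratic_factor p1.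
  apply; rewrite ?size_XsubC // => u.
  rewrite rmorphB /= horner_mx_X horner_mx_C mulmxBr mul_mx_scalar.
  move=> /subr0_eq uE; exists [:: (a, u)]; first by rewrite big_seq1.
  by move=> i; rewrite inE => /eqP ->.
apply.
  rewrite size_polyDl size_exp_XsubC //.
  by rewrite (leq_ltn_trans (size_polyC_leq1 _)).
move=> u; rewrite rmorphD rmorphXn /= horner_mx_C mulmxDr mul_mx_scalar.
rewrite expr2 mulmxA => /(congr1 (ip ^~ u)).
set N := horner_mx M _; rewrite ipDl ip0l.
rewrite (horner_self_adjoint ('X - a%:P)) -/N ipZl => /eqP.
rewrite paddr_eq0 ?ip_ge0 ?(mulr_ge0 (sqr_ge0 _)) ?ip_ge0 //.
rewrite mulf_eq0 sqrf_eq0 (negbTE b0) /= => /andP[_ /eqP/ip_eq0 ->].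
by exists [::]; rewrite ?big_nil.
Qed.

End Horner.

(** Polynomials are evaluated at matrices of size [n.+1], where they form a
    nontrivial ring; this is why dimension 0 is treated apart. *)
Lemma self_adjoint_eigen_sum (R : realType) d (ip : {dot 'rV[R]_d for idfun})
   (T : 'End('rV[R]_d)) v :
  self_adjoint ip T -> is_eigen_sum T v.
Proof.
case: d ip T v => [|n] ip T v Tsa.
  by exists [::]; rewrite ?big_nil // [v]thinmx0.
have TE u : T u = u *m lin1_mx T by rewrite mul_rV_lin1.
have [x y|s vE sE] := @matrix_eigen_sum _ n ip (lin1_mx T) _ v.
  by rewrite -!TE.
by exists s => // i /sE; rewrite TE.
Qed.

(** * Orthogonal projections *)

Section OrthProj.
Context {R : realType} {d : nat} (ip : {dot 'rV[R]_d for idfun}).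
Implicit Types (M : {vspace 'rV[R]_d}) (x y : 'rV[R]_d).

Lemma orth_proj_mem M x : orth_proj ip M x \in M.
Proof. by have [] := (orth_projP ip M x _).1 erefl. Qed.

Lemma orth_proj_perp M x y : y \in M -> ip x y = ip (orth_proj ip M x) y.
Proof.
move=> yM; have [_ /(_ y yM)/eqP] := (orth_projP ip M x _).1 erefl.
by rewrite ipBl subr_eq0 => /eqP.
Qed.

Lemma orth_proj_id M x : x \in M -> orth_proj ip M x = x.
Proof.
move=> xM; symmetry; apply/orth_projP; split=> // y _.
by rewrite subrr ip0l.
Qed.

Lemma orth_projK M x : orth_proj ip M (orth_proj ip M x) = orth_proj ip M x.
Proof. exact/orth_proj_id/orth_proj_mem. Qed.

Lemma orth_proj_eq0 M x : {in M, forall y, ip x y = 0} -> orth_proj ip M x = 0.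
Proof.
move=> xM; symmetry; apply/orth_projP; rewrite mem0v; split=> // y yM.
by rewrite subr0 xM.
Qed.

Lemma orth_proj_self_adjoint M : self_adjoint ip (orth_proj ip M).
Proof.
move=> x y; rewrite ipC (orth_proj_perp y (orth_proj_mem M x)).
by rewrite (orth_proj_perp x (orth_proj_mem M y)) ipC.
Qed.

Lemma orth_proj_sqnorm M x :
  ip (orth_proj ip M x) (orth_proj ip M x) = ip (orth_proj ip M x) x.
Proof. by rewrite -(orth_proj_perp x (orth_proj_mem M x)) ipC. Qed.

Lemma orth_proj_pythagoras M x : ip x x =
  ip (orth_proj ip M x) (orth_proj ip M x) +
  ip (x - orth_proj ip M x) (x - orth_proj ip M x).
Proof.
rewrite ipBl !ipBr orth_proj_sqnorm [ip x (orth_proj _ _ _)]ipC; ring.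
Qed.

End OrthProj.

(** * Projections on eigenspaces *)

Section Eigen.
Context {R : realType} {d : nat} (ip : {dot 'rV[R]_d for idfun}).
Variable T : 'End('rV[R]_d).
Hypothesis Tsa : self_adjoint ip T.
Implicit Types (v w : 'rV[R]_d) (l m : R).

Local Notation eigen_proj l := (orth_proj ip (passmx.leigenspace T l)).

Lemma mem_leigenspace l w : (w \in passmx.leigenspace T l) = (T w == l *: w).
Proof.
rewrite /passmx.leigenspace memv_ker add_lfunE opp_lfunE scale_lfunE id_lfunE.
by rewrite subr_eq0.
Qed.

Lemma eigen_proj_eigen l v : T (eigen_proj l v) = l *: eigen_proj l v.
Proof. by apply/eqP; rewrite -mem_leigenspace orth_proj_mem. Qed.

Lemma eigen_orth l m v w :
  T v = l *: v -> T w = m *: w -> l != m -> ip v w = 0.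
Proof.
move=> vl wm lm; have /eqP := Tsa v w.
rewrite vl wm ipZl ipZr -subr_eq0 -mulrBl mulf_eq0 subr_eq0 (negbTE lm) /=.
by move/eqP.
Qed.

(** Eigenvectors for other eigenvalues are orthogonal to the eigenspace.
    Consequently, any expression of a vector as a sum of eigenvectors
    determines the set [eigenvalues_at] of that vector. *)
Lemma eigen_proj_of_eigen l m w :
  T w = m *: w -> eigen_proj l w = if m == l then w else 0.
Proof.
move=> wm; have [<-|ml] := eqVneq.
  by rewrite orth_proj_id // mem_leigenspace wm.
apply: orth_proj_eq0 => v; rewrite mem_leigenspace => /eqP vl.
exact: (eigen_orth wm vl).
Qed.

Lemma eigenvalues_atP l v : eigenvalues_at ip v T l <-> eigen_proj l v != 0.
Proof.
split=> [[]//|lv]; split=> //=; rewrite /passmx.leigenvalue.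
apply: contraNneq lv => l0; rewrite -memv0 -l0; exact: orth_proj_mem.
Qed.

Lemma iter_self_adjoint k v w : ip (iter k T v) w = ip v (iter k T w).
Proof. by elim: k v w => //= k IH v w; rewrite Tsa IH -iterSr. Qed.

(** The components of [v] on the eigenspaces are obtained from an arbitrary
    sum of eigenvectors by grouping the ones that share their eigenvalue. *)
Lemma spectral_decomposition v : exists s : seq R,
  [/\ uniq s, {in s, forall l, eigen_proj l v != 0}
    & v = \sum_(l <- s) eigen_proj l v].
Proof.
have [t vE tE] := self_adjoint_eigen_sum v Tsa.
exists [seq l <- undup [seq i.1 | i <- t] | eigen_proj l v != 0]; split.
- by rewrite filter_uniq ?undup_uniq.
- by move=> l; rewrite mem_filter => /andP[].
suff vP : v = \sum_(l <- undup [seq i.1 | i <- t]) eigen_proj l v.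
  rewrite big_filter {1}vP (bigID (fun l => eigen_proj l v != 0)) /=.
  by rewrite [X in _ + X]big1 ?addr0 // => l /negPn/eqP.
rewrite {2}vE (eq_bigr (fun l => \sum_(i <- t) eigen_proj l i.2)); last first.
  by move=> l _; rewrite linear_sum.
rewrite exchange_big {1}vE /= big_seq [RHS]big_seq; apply: eq_bigr => i it.
have iu : i.1 \in undup [seq i.1 | i <- t] by rewrite mem_undup map_f.
rewrite (bigD1_seq i.1) ?undup_uniq //= big1 ?addr0; last first.
  by move=> l; rewrite (eigen_proj_of_eigen _ (tE _ it)) eq_sym => /negbTE ->.
by rewrite (eigen_proj_of_eigen _ (tE _ it)) eqxx.
Qed.

End Eigen.

Section Iter.
Context {R : realType} {d : nat}.
Variable T : 'End('rV[R]_d).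

Lemma iter_lfun_eigen k l w : T w = l *: w -> iter k T w = l ^+ k *: w.
Proof.
move=> wl; elim: k => [|k /= ->]; rewrite ?scale1r //.
by rewrite linearZ /= wl scalerA exprSr.
Qed.

Lemma iter_lfun_sum k (I : Type) (r : seq I) (w : I -> 'rV[R]_d) :
  iter k T (\sum_(i <- r) w i) = \sum_(i <- r) iter k T (w i).
Proof. by elim: k => //= k ->; rewrite linear_sum. Qed.

Lemma iter_lfun_fix k p v : T p = p -> iter k T (v + p) = iter k T v + p.
Proof. by move=> Tp; elim: k => //= k ->; rewrite linearD /= Tp. Qed.

End Iter.

(** * Rate of a sum of geometric sequences *)

(** After division by the power [m ^ (2 k)] of the dominant ratio [m = l i0],
    the sum converges to the total weight of the indices at which the maximum
    [m] is reached, which is positive; so consecutive quotients tend to 1. *)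
Lemma power_sum_rate (R : realType) (I : eqType) (r : seq I) (c l : I -> R) i0 :
    i0 \in r -> 0 < c i0 -> 0 < l i0 ->
    {in r, forall i, 0 <= c i} -> {in r, forall i, 0 <= l i <= l i0} ->
  let g k := \sum_(i <- r) c i * (l i ^+ 2) ^+ k in
  (fun k => Num.sqrt (g k.+1) / Num.sqrt (g k)) @ \oo --> l i0.
Proof.
move=> ri c0 m0 cr lr g; set m := l i0 in m0 lr *.
pose q i := (l i / m) ^+ 2.
pose h (k : nat) := \sum_(i <- r | i \in r) c i * q i ^+ k.
pose L := \sum_(i <- r | i \in r) c i * (q i == 1)%:R.
have gE k : g k = (m ^+ 2) ^+ k * h k.
  rewrite /g /h -big_seq mulr_sumr; apply: eq_bigr => i _.
  rewrite mulrCA; congr (_ * _); rewrite -exprMn /q -exprMn; congr (_ ^+ 2 ^+ k).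
  by rewrite mulrC divfK // gt_eqF.
have q01 i : i \in r -> 0 <= q i <= 1.
  move=> /lr /andP[li0 lim]; rewrite sqr_ge0 /= expr_le1 ?ler_pdivrMr ?mul1r //.
  by rewrite divr_ge0 // ltW.
have hL : h k @[k --> \oo] --> L.
  apply: cvg_big => //; first exact: add_continuous.
  move=> i /q01 /andP[q0 q1]; apply: cvgM; first exact: cvg_cst.
  have [->|qi] := eqVneq (q i) 1.
    rewrite (_ : GRing.exp 1 = cst 1); first exact: cvg_cst.
    by apply/funext => k; rewrite expr1n.
  apply: cvg_expr; rewrite ger0_norm // lt_neqAle qi //.
have L0 : 0 < L.
  rewrite /L (big_rem i0) //= ri.
  have -> : q i0 = 1 by rewrite /q divff ?gt_eqF // expr1n.
  rewrite eqxx mulr1 ltr_pwDl // sumr_ge0 // => i ir.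
  by rewrite mulr_ge0 ?cr.
have ratio : (m ^+ 2 * (h k.+1 / h k)) @[k --> \oo] --> m ^+ 2 * (L / L).
  apply: cvgM; first exact: cvg_cst.
  apply: cvgM; first by rewrite (cvg_shiftS h).
  by apply: cvgV => //; rewrite gt_eqF.
rewrite divff ?gt_eqF // mulr1 in ratio.
rewrite -[X in _ --> X](ger0_norm (ltW m0)) -sqrtr_sqr.
have := cvg_comp _ _ ratio (@sqrt_continuous R _); apply: cvg_trans.
apply: near_eq_cvg; apply: nearW => k /=.
have h0 j : 0 <= h j.
  by apply: sumr_ge0 => i ir; rewrite mulr_ge0 ?cr // exprn_ge0 ?sqr_ge0.
rewrite !gE (exprSr _ k) -mulrA.
rewrite !(sqrtrM _ (sqr_ge0 _), sqrtrM _ (exprn_ge0 _ (sqr_ge0 _))).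
rewrite (sqrtrM _ (h0 _)) (sqrtrV (h0 _)).
have : 0 < Num.sqrt ((m ^+ 2) ^+ k) by rewrite sqrtr_gt0 !exprn_gt0.
set x := Num.sqrt ((m ^+ 2) ^+ k) => x0.
have [->|hk] := eqVneq (Num.sqrt (h k)) 0; first by rewrite !(mulr0, invr0).
by field; rewrite hk gt_eqF.
Qed.

(** * A pair of subspaces *)

Section TwoSubspaces.
Context {R : realType} {d : nat} (ip : {dot 'rV[R]_d for idfun}).
Variables C D : {vspace 'rV[R]_d}.
Local Notation PC := (orth_proj ip C).
Local Notation PD := (orth_proj ip D).

Lemma self_adjoint_PQP (P Q : 'End('rV[R]_d)) :
  self_adjoint ip P -> self_adjoint ip Q -> self_adjoint ip (P \o Q \o P)%VF.
Proof. by move=> Psa Qsa x y; rewrite !comp_lfunE Psa Qsa Psa. Qed.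

(** The eigenvalue [s] of [PC PD] on [u] is the squared cosine of the angle
    between [u] and [D]. *)
Lemma sqnorm_cross_proj s u : u \in C -> PC (PD u) = s *: u ->
  ip (PD u) (PD u) = s * ip u u.
Proof.
move=> uC us; rewrite orth_proj_sqnorm -[in X in ip _ X](orth_proj_id ip uC).
by rewrite -orth_proj_self_adjoint us ipZl.
Qed.

(** Spectral decomposition of [y] for [PC PD PC].  The components lie in [C]:
    those for nonzero eigenvalues because they are in the range of [PC], and
    the one in the kernel because it is [y] minus the others. *)
Lemma principal_decomposition y : y \in C ->
    {in (C :&: D)%VS, forall z, ip z y = 0} ->
  exists (s : seq R) (u : R -> 'rV[R]_d),
  [/\ uniq s, y = \sum_(l <- s) u l,
      {in s &, forall l m, l != m -> ip (u l) (u m) = 0} &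
      {in s, forall l, [/\ 0 <= l < 1, u l \in C, u l != 0 &
                           PC (PD (u l)) = l *: u l]}].
Proof.
move=> yC yCD; pose T := (PC \o PD \o PC)%VF.
have Tsa : self_adjoint ip T.
  by apply: self_adjoint_PQP; exact: orth_proj_self_adjoint.
have [s [us s0 yE]] := spectral_decomposition Tsa y.
pose u l := orth_proj ip (passmx.leigenspace T l) y.
have uE l : T (u l) = l *: u l by exact: eigen_proj_eigen.
have uo : {in s &, forall l m, l != m -> ip (u l) (u m) = 0}.
  by move=> l m _ _; exact: (eigen_orth Tsa (uE l) (uE m)).
exists s, u; split=> // l ls.
(* the components for nonzero eigenvalues are in the range of [PC] *)
have unz m : m != 0 -> u m \in C.
  move=> m0; rewrite -[u m](scalerK m0) -uE rpredZ //.
  by rewrite !comp_lfunE orth_proj_mem.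
have uC : u l \in C.
  have [l0|l0] := eqVneq l 0; last exact: unz.
  have -> : u l = y - \sum_(m <- s | m != l) u m.
    by rewrite {1}yE (bigD1_seq l) //= addrK.
  by rewrite rpredB // rpred_sum // => m; rewrite l0; apply: unz.
have u0 : u l != 0 by exact: s0.
have lE : PC (PD (u l)) = l *: u l.
  by rewrite -uE !comp_lfunE (orth_proj_id ip uC).
have uu0 : 0 < ip (u l) (u l) by rewrite ip_gt0.
have PDu := sqnorm_cross_proj uC lE.
split=> //; apply/andP; split.
  by rewrite -(pmulr_lge0 _ uu0) -PDu ip_ge0.
have pyth := orth_proj_pythagoras ip D (u l); rewrite PDu in pyth.
rewrite lt_neqAle; apply/andP; split; last first.
  rewrite -(ler_pM2r uu0) mul1r {2}pyth lerDl; exact: ip_ge0.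
(* if [l = 1], then [PD] preserves the norm of [u l], so that [u l] is in [D]
   as well; it is then orthogonal to [y], of which it is a component *)
apply: contraNneq u0 => l1; rewrite l1 mul1r -l1 in pyth.
have /subr0_eq uD : u l - PD (u l) = 0.
  by apply: (@ip_eq0 _ _ ip); apply: (addrI (ip (u l) (u l))); rewrite addr0 -pyth.
have uCD : u l \in (C :&: D)%VS by rewrite memv_cap uC uD orth_proj_mem.
apply/eqP/(@ip_eq0 _ _ ip); rewrite -(yCD _ uCD) [in RHS]yE [RHS]ipC ip_suml.
rewrite (bigD1_seq l) //= big_seq_cond big1 ?addr0 // => m /andP[ms ml].
by rewrite -/(u m) uo.
Qed.

(** With [t] the square root of [s], the eigenvalues [(1 + t) / 2] and
    [(1 - t) / 2] of [(PC + PD) / 2] on the plane of [u] and [PD u] are indexed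
    by the sign [b], the larger one being that of [b = false]. *)
Definition avg_eigenvalue (b : bool) (s : R) :=
  2^-1 * (1 + (-1) ^+ b * Num.sqrt s).

(** The vectors [(u + PD u / t) / 2] and [(u - PD u / t) / 2], where [t] is the
    square root of [s].  When [s = 0] both are [u / 2], because then
    [PD u = 0], and the two eigenvalues merge into [1/2]; thanks to this no
    statement below needs to distinguish the case [s = 0]. *)
Definition avg_eigenvector (b : bool) s u :=
  2^-1 *: (u + ((-1) ^+ b * (Num.sqrt s)^-1) *: PD u).

Section Plane.
Variables (s : R) (u : 'rV[R]_d).
Hypotheses (s0 : 0 <= s) (uC : u \in C) (us : PC (PD u) = s *: u).

Lemma cross_proj_eq0 : s = 0 -> PD u = 0.
Proof.
by move=> sz; apply: (@ip_eq0 _ _ ip); rewrite (sqnorm_cross_proj uC us) sz mul0r.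
Qed.

Let sqrtK : (Num.sqrt s)^-1 * s = Num.sqrt s.
Proof.
have [->|t0] := eqVneq s 0; first by rewrite mulr0 sqrtr0.
by rewrite -{2}(sqr_sqrtr s0) expr2 mulKf // sqrtr_eq0 -ltNge lt0r t0.
Qed.

Lemma avg_eigenvectorP b :
  (2^-1 *: (PC + PD) : 'End('rV[R]_d)) (avg_eigenvector b s u) =
  avg_eigenvalue b s *: avg_eigenvector b s u.
Proof.
rewrite /avg_eigenvector /avg_eigenvalue scale_lfunE add_lfunE.
rewrite !linearZ /= !linearD /=.
rewrite !linearZ /= us orth_projK (orth_proj_id ip uC).
have [sz|sN0] := eqVneq s 0.
  by rewrite cross_proj_eq0 // sz sqrtr0 !(mulr0, scale0r, scaler0, addr0, mulr1).
have t0 : Num.sqrt s != 0 by rewrite sqrtr_eq0 -ltNge lt0r sN0.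
rewrite -[X in X *: u](sqr_sqrtr s0); set t := Num.sqrt s in t0 *.
rewrite !scalerA -(scalerDl u) -(scalerDl (PD u)).
by case: b; rewrite ?expr0 ?expr1; congr (_ *: _ + _ *: _); field.
Qed.

Lemma avg_eigenvector_sum :
  avg_eigenvector false s u + avg_eigenvector true s u = u.
Proof.
rewrite /avg_eigenvector expr0 expr1 mul1r mulN1r scaleNr -scalerDr.
rewrite addrACA subrr addr0 -mulr2n -(scaler_nat 2 u).
by rewrite scalerA mulVf ?scale1r ?pnatr_eq0.
Qed.

Lemma avg_eigenvector_ip b :
  ip (avg_eigenvector b s u) u = avg_eigenvalue b s * ip u u.
Proof.
rewrite ipZl ipDl ipZl -orth_proj_sqnorm (sqnorm_cross_proj uC us).
rewrite mulrA -(mulrA _ _ s) sqrtK /avg_eigenvalue; ring.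
Qed.

End Plane.

Lemma avg_eigenvalue_bounds b s : 0 <= s < 1 -> 0 < avg_eigenvalue b s < 1.
Proof.
move=> /andP[s0 s1]; have t0 := sqrtr_ge0 s.
have t1 : Num.sqrt s < 1 by rewrite -[ltRHS]sqrtr1 ltr_sqrt.
by rewrite /avg_eigenvalue; case: b; rewrite ?expr0 ?expr1; apply/andP; split; lra.
Qed.

(** The positive term for [true] makes the inequality strict, and the other
    one alone suffices for the large one: with [t] the square root of [s] and
    [m = (1 + t) / 2], one has [t <= m] and [t <= m ^ 2], whence
    [t ^ (j + 2) <= m ^ (2 j + 3)], while [s ^ (2 j + 1) = t ^ (4 j + 2)]. *)
Lemma avg_eigenvalue_gt s j : 0 <= s < 1 ->
  s ^+ (j.*2.+1) < avg_eigenvalue false s ^+ (j.+1.*2.+1)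
                   + avg_eigenvalue true s ^+ (j.+1.*2.+1).
Proof.
move=> s01; have /andP[s0 s1] := s01.
have /andP[m0 _] := avg_eigenvalue_bounds true s01.
have /andP[p0 _] := avg_eigenvalue_bounds false s01.
rewrite -[ltLHS]addr0 ler_ltD ?exprn_gt0 //.
have t0 := sqrtr_ge0 s.
have t1 : Num.sqrt s < 1 by rewrite -[ltRHS]sqrtr1 ltr_sqrt.
rewrite -[s in s ^+ _]sqr_sqrtr // /avg_eigenvalue expr0 mul1r in p0 *.
move: t0 t1 p0; set t := Num.sqrt s => t0 t1 p0.
have pt : t <= 2^-1 * (1 + t) by lra.
have p2 : t <= (2^-1 * (1 + t)) ^+ 2.
  have := sqr_ge0 (1 - t); rewrite expr2 => h; rewrite expr2; lra.
have : t ^+ j.+2 <= (2^-1 * (1 + t)) ^+ j.+1.*2.+1.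
  rewrite [leLHS]exprS [leRHS]exprS ler_pM ?exprn_ge0 //.
  by rewrite -mul2n exprM; rewrite lerXn2r // nnegrE ?sqr_ge0.
apply: le_trans; rewrite -exprM ler_wiXn2l ?(ltW t1) //.
lia.
Qed.

End TwoSubspaces.

(** * The two iterations *)

Section Sequences.
Context {R : realType} {d : nat} (ip : {dot 'rV[R]_d for idfun}).
Variables A B C D : {vspace 'rV[R]_d}.
Local Notation PA := (orth_proj ip A).
Local Notation PB := (orth_proj ip B).
Local Notation PC := (orth_proj ip C).
Local Notation PD := (orth_proj ip D).
(** [C] is the subspace that contains the starting point, the order of [A] and
    [B] being relevant for the alternating projections only. *)
Hypothesis CD : (C = A /\ D = B) \/ (C = B /\ D = A).
Let T : 'End('rV[R]_d) := (PB \o PA \o PB)%VF.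
Let S : 'End('rV[R]_d) := 2^-1 *: (PA + PB).

Let S_CD : S = 2^-1 *: (PC + PD).
Proof. by case: CD => -[-> ->] //; rewrite [PB + _]addrC. Qed.

Lemma alternating_self_adjoint : self_adjoint ip T.
Proof. by apply: self_adjoint_PQP; apply: orth_proj_self_adjoint. Qed.

Lemma avg_self_adjoint : self_adjoint ip S.
Proof.
move=> v w; rewrite !scale_lfunE !add_lfunE ipZl ipZr ipDl ipDr.
by congr (_ * (_ + _)); apply: orth_proj_self_adjoint.
Qed.

Lemma alternating_eigen s u : u \in C -> PC (PD u) = s *: u ->
  T (PB u) = s *: PB u.
Proof.
case: CD => -[-> ->] uC us; rewrite !comp_lfunE orth_projK ?us ?linearZ //=.
by rewrite (orth_proj_id ip uC) us.
Qed.

(** Moving the parentheses turns the iterates of [PA PB] into those of the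
    self-adjoint operator [PB PA PB], up to one projection on either side. *)
Lemma alternating_iter j y :
  iter j.+1 (PA \o PB)%VF y = PA (iter j T (PB y)).
Proof.
suff <- : PB (iter j (PA \o PB)%VF y) = iter j T (PB y).
  by rewrite iterS comp_lfunE.
by elim: j => //= j <-; rewrite !comp_lfunE orth_projK.
Qed.

Variables (s : seq R) (u : R -> 'rV[R]_d).
Hypotheses (us : uniq s)
  (uo : {in s &, forall l m, l != m -> ip (u l) (u m) = 0})
  (sP : {in s, forall l, [/\ 0 <= l < 1, u l \in C, u l != 0 &
                           PC (PD (u l)) = l *: u l]}).
Let y := \sum_(l <- s) u l.

(** [|a_{j+1}|^2] is [<T^(2 j + 1) (PB y), PB y>], because [PA] and [PB] are
    self-adjoint and idempotent; the odd exponent comes from the last [PA]. *)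
Lemma alternating_sqnorm j (aj := iter j.+1 (PA \o PB)%VF y) :
  ip aj aj = \sum_(l <- s) l ^+ j.*2.+1 * ip (PB (u l)) (PB (u l)).
Proof.
rewrite /aj alternating_iter orth_proj_sqnorm.
have PBT z : PB (T z) = T z by rewrite !comp_lfunE orth_projK.
have PBj : iter j T (PB y) = PB (iter j T (PB y)).
  by case: j {aj} => [|j]; rewrite ?orth_projK // iterS PBT.
rewrite PBj -orth_proj_self_adjoint -PBj.
have -> : PB (PA (iter j T (PB y))) = iter j.+1 T (PB y).
  by rewrite iterS {2}/T !comp_lfunE -PBj.
have -> : PB y = \sum_(l <- s) PB (u l) by rewrite linear_sum.
rewrite !iter_lfun_sum.
rewrite [X in ip X _](eq_big_seq (fun l => l ^+ j.+1 *: PB (u l))); last first.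
  by move=> l /sP[_ uC _ lE]; apply: iter_lfun_eigen; exact: alternating_eigen.
rewrite [X in ip _ X](eq_big_seq (fun l => l ^+ j *: PB (u l))); last first.
  by move=> l /sP[_ uC _ lE]; apply: iter_lfun_eigen; exact: alternating_eigen.
rewrite ip_sum_orth //; last first.
  move=> l m /sP[_ lC _ lE] /sP[_ mC _ mE] lm; rewrite ipZl ipZr.
  by rewrite (eigen_orth alternating_self_adjoint (alternating_eigen lC lE)
      (alternating_eigen mC mE) lm) !mulr0.
apply: eq_bigr => l _; rewrite ipZl ipZr mulrA -exprD; congr (_ ^+ _ * _); lia.
Qed.

Local Notation ev := avg_eigenvalue.
Local Notation e b l := (avg_eigenvector ip D b l (u l)).

Lemma avg_eigen b : {in s, forall l, S (e b l) = ev b l *: e b l}.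
Proof.
by move=> l /sP[/andP[l0 _] uC _ lE]; rewrite S_CD (avg_eigenvectorP l0 uC).
Qed.

(** Orthogonality to the [u m] is enough for the norms below, since
    [|S^k y|^2 = <S^(2 k) y, y>] only involves one iterated factor; the two
    eigenvectors for the same [l] need not be orthogonal when [l = 0]. *)
Lemma avg_eigenvector_orth b :
  {in s &, forall l m, l != m -> ip (e b l) (u m) = 0}.
Proof.
move=> l m ls ms lm; have [_ lC _ lE] := sP ls; have [_ mC _ mE] := sP ms.
rewrite ipZl ipDl ipZl uo // -[in X in ip (PD _) X](orth_proj_id ip mC).
by rewrite -orth_proj_self_adjoint lE ipZl uo // !(mulr0, addr0).
Qed.

Lemma avg_sqnorm k (xk := iter k S y) :
  ip xk xk = \sum_(l <- s)
    (ev false l ^+ k.*2.+1 + ev true l ^+ k.*2.+1) * ip (u l) (u l).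
Proof.
rewrite /xk -iter_self_adjoint -?iterD; last exact: avg_self_adjoint.
rewrite /y iter_lfun_sum.
pose v b l := ev b l ^+ (k + k) *: e b l.
rewrite (eq_big_seq (fun l => v false l + v true l)); last first.
  move=> l ls; rewrite -{1}(avg_eigenvector_sum ip D l (u l)).
  pose f b := e b l; rewrite -[LHS]/(iter (k + k) S (f false + f true)).
  rewrite (_ : f false + f true = \sum_(b : bool) f b); last by rewrite big_bool addrC.
  rewrite iter_lfun_sum big_bool addrC.
  by congr (_ + _); apply: iter_lfun_eigen; exact: avg_eigen.
rewrite ip_sum_orth //; last first.
  move=> l m ls ms lm; rewrite ipDl !(ipZl ip (_ ^+ _)).
  by rewrite !avg_eigenvector_orth // !mulr0 addr0.
apply: eq_big_seq => l /sP[/andP[l0 _] uC _ lE].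
rewrite ipDl !(ipZl ip (_ ^+ _)) !(avg_eigenvector_ip l0 uC lE).
move: (ev false l) (ev true l) => f g.
by rewrite !mulrA -!exprSr addnn -mulrDl.
Qed.

(** Term by term, [PB] being a contraction. *)
Lemma avg_sqnorm_gt j : s != [::] ->
  ip (iter j.+1 (PA \o PB)%VF y) (iter j.+1 (PA \o PB)%VF y) <
  ip (iter j.+1 S y) (iter j.+1 S y).
Proof.
move=> s0; rewrite alternating_sqnorm avg_sqnorm big_seq [ltRHS]big_seq.
apply: ltr_sum.
  by case: (s) s0 => //= l s' _; rewrite inE eqxx.
move=> l /sP[l01 _ u0 _]; have /andP[l0 _] := l01.
apply: (@le_lt_trans _ _ (l ^+ j.*2.+1 * ip (u l) (u l))).
  rewrite ler_wpM2l ?exprn_ge0 // [leRHS](orth_proj_pythagoras ip B).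
  by rewrite lerDl ip_ge0.
by rewrite ltr_pM2r ?ip_gt0 // avg_eigenvalue_gt.
Qed.

Variables (p : 'rV[R]_d) (lam : R).
Hypotheses (Tp : T p = p) (Sp : S p = p).
Hypotheses (lams : lam \in s) (lam_max : {in s, forall l, l <= lam})
  (lam0 : 0 < lam).

Let lam01 : 0 <= lam < 1. Proof. by have [] := sP lams. Qed.

Let PBu_gt0 : 0 < ip (PB (u lam)) (PB (u lam)).
Proof.
have [_ uC u0 lE] := sP lams; case: CD => -[cC cD].
  by rewrite -cD (sqnorm_cross_proj uC lE) mulr_gt0 ?ip_gt0.
by rewrite -cC (orth_proj_id ip uC) ip_gt0.
Qed.

Lemma alternating_sqnorm_gt0 j :
  0 < ip (iter j.+1 (PA \o PB)%VF y) (iter j.+1 (PA \o PB)%VF y).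
Proof.
rewrite alternating_sqnorm (bigD1_seq lam) //= ltr_pwDl //.
  by rewrite mulr_gt0 ?exprn_gt0.
rewrite big_seq_cond sumr_ge0 // => l /andP[/sP[/andP[l0 _] _ _ _] _].
by rewrite mulr_ge0 ?exprn_ge0 ?ip_ge0.
Qed.

(** The expression of the squared norms is valid from the first iterate on
    only, whence a shift of the index. *)
Lemma alternating_rate :
  (fun k => ipnorm ip (iter k.+1 (PA \o PB)%VF y) /
            ipnorm ip (iter k (PA \o PB)%VF y)) @ \oo --> lam.
Proof.
pose g k := \sum_(l <- s) l * ip (PB (u l)) (PB (u l)) * (l ^+ 2) ^+ k.
have gE k : ipnorm ip (iter k.+1 (PA \o PB)%VF y) = Num.sqrt (g k).
  rewrite /ipnorm alternating_sqnorm; congr Num.sqrt; apply: eq_bigr => l _.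
  by rewrite -exprM mul2n exprSr -mulrA mulrC.
rewrite -(cvg_shiftS (fun k => ipnorm ip (iter k.+1 (PA \o PB)%VF y) /
            ipnorm ip (iter k (PA \o PB)%VF y))).
suff: (fun k => Num.sqrt (g k.+1) / Num.sqrt (g k)) @ \oo --> lam.
  have -> // : (fun k => Num.sqrt (g k.+1) / Num.sqrt (g k)) =
    (fun k => ipnorm ip (iter k.+2 (PA \o PB)%VF y) /
              ipnorm ip (iter k.+1 (PA \o PB)%VF y)).
  by apply/funext => k; rewrite !gE.
apply: (@power_sum_rate R _ s (fun l => l * ip (PB (u l)) (PB (u l))) id lam) => //.
- by rewrite mulr_gt0.
- by move=> l /sP[/andP[l0 _] _ _ _]; rewrite mulr_ge0 ?ip_ge0.
- by move=> l ls; rewrite lam_max //; have [/andP[-> _]] := sP ls.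
Qed.

Lemma avg_eigenvalue_max b : {in s, forall l, 0 <= ev b l <= ev false lam}.
Proof.
move=> l ls; have [l01 _ _ _] := sP ls.
have /andP[/ltW -> _] /= := avg_eigenvalue_bounds b l01.
have : Num.sqrt l <= Num.sqrt lam by rewrite ler_wsqrtr ?lam_max.
have := sqrtr_ge0 l; rewrite /avg_eigenvalue.
by case: b; rewrite ?expr0 ?expr1; lra.
Qed.

Lemma avg_rate :
  (fun k => ipnorm ip (iter k.+1 S y) / ipnorm ip (iter k S y))
    @ \oo --> ev false lam.
Proof.
pose r := [seq (l, b) | l <- s, b <- [:: false; true]].
have rP i : i \in r -> i.1 \in s.
  by move=> /allpairsP[[l b] /= [ls _ ->]].
pose g k := \sum_(i <- r)
  ev i.2 i.1 * ip (u i.1) (u i.1) * (ev i.2 i.1 ^+ 2) ^+ k.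
have gE k : ipnorm ip (iter k S y) = Num.sqrt (g k).
  rewrite /ipnorm avg_sqnorm /g big_allpairs; congr Num.sqrt; apply: eq_bigr => l _.
  rewrite big_cons big_seq1 /= -!exprM !mul2n !exprS.
  by rewrite mulrDl; congr (_ + _); rewrite mulrAC.
suff: (fun k => Num.sqrt (g k.+1) / Num.sqrt (g k)) @ \oo --> ev false lam.
  have -> // : (fun k => Num.sqrt (g k.+1) / Num.sqrt (g k)) =
    (fun k => ipnorm ip (iter k.+1 S y) / ipnorm ip (iter k S y)).
  by apply/funext => k; rewrite !gE.
have [_ _ u0 _] := sP lams.
have /andP[ev0 _] := avg_eigenvalue_bounds false lam01.
apply: (@power_sum_rate R _ r (fun i => ev i.2 i.1 * ip (u i.1) (u i.1))
  (fun i => ev i.2 i.1) (lam, false)) => //=.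
- by apply/allpairsP; exists (lam, false).
- by rewrite mulr_gt0 ?ip_gt0.
- move=> i /rP/(avg_eigenvalue_max i.2)/andP[i0 _].
  by rewrite mulr_ge0 ?ip_ge0.
by move=> i /rP/(avg_eigenvalue_max i.2).
Qed.

(** In [u m = PB (u m) + (u m - PB (u m))], the two terms are eigenvectors of
    [T] for [m] and for 0, so that the component of [y + p] for an eigenvalue
    [l] other than 0 and 1 is [PB (u l)] if [l] is in [s], and 0 otherwise. *)
Lemma alternating_max_eigenvalue :
  is_max (eigenvalues_at ip (y + p) T `\` [set 0; 1]) lam.
Proof.
have Tsa := alternating_self_adjoint.
have compE l : l != 0 -> l != 1 ->
    orth_proj ip (passmx.leigenspace T l) (y + p) =
    \sum_(m <- s) if m == l then PB (u m) else 0.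
  move=> l0 l1; rewrite linearD /= (@eigen_proj_of_eigen _ _ _ _ Tsa l 1 p); last first.
    by rewrite scale1r.
  rewrite eq_sym (negbTE l1) addr0 linear_sum /=.
  apply: eq_big_seq => m /sP[_ uC _ mE].
  rewrite -{1}(subrK (PB (u m)) (u m)) linearD /=.
  rewrite (eigen_proj_of_eigen Tsa _ (alternating_eigen uC mE)).
  rewrite (@eigen_proj_of_eigen _ _ _ _ Tsa l 0 (u m - PB (u m))); last first.
    by rewrite scale0r !comp_lfunE linearB /= orth_projK subrr !linear0.
  by rewrite eq_sym (negbTE l0) add0r.
split.
  have /andP[_ lam1] := lam01.
  split; last by case => /= lamE; move: lam0 lam1; rewrite lamE ltxx.
  apply/eigenvalues_atP; rewrite compE ?(gt_eqF lam0) ?(lt_eqF lam1) //.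
  rewrite (bigD1_seq lam) //= eqxx big1 ?addr0 => [|m /negbTE -> //].
  by rewrite -(ip_gt0 ip).
move=> l [/eigenvalues_atP le0 l01].
have l0 : l != 0 by apply: contra_notN l01 => /eqP ->; left.
have l1 : l != 1 by apply: contra_notN l01 => /eqP ->; right.
rewrite compE // in le0; apply: lam_max; apply: contraNT le0 => ls.
by rewrite big_seq big1 // => m ms; case: eqVneq => // ml; rewrite -ml ms in ls.
Qed.

(** As [lam > 0], the value [(1 + sqrt lam) / 2] is reached by one of the
    eigenvectors [e b l] only, namely [e false lam], which is thus the
    component of [y + p] for it; it is nonzero because its inner product with
    [u lam] is positive. *)
Lemma avg_max_eigenvalue :
  is_max (eigenvalues_at ip (y + p) S `\` [set 0; 1]) (ev false lam).
Proof.
have Ssa := avg_self_adjoint.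
have compE l : l != 1 ->
    orth_proj ip (passmx.leigenspace S l) (y + p) =
    \sum_(m <- s) ((if ev false m == l then e false m else 0) +
                   (if ev true m == l then e true m else 0)).
  move=> l1; rewrite linearD /= (@eigen_proj_of_eigen _ _ _ _ Ssa l 1 p); last first.
    by rewrite scale1r.
  rewrite eq_sym (negbTE l1) addr0 linear_sum /=; apply: eq_big_seq => m ms.
  rewrite -{1}(avg_eigenvector_sum ip D m (u m)) linearD /=.
  by rewrite !(eigen_proj_of_eigen Ssa _ (avg_eigen _ ms)).
have /andP[ev0 ev1] := avg_eigenvalue_bounds false lam01.
split.
  split; last by case => /= evE; move: ev0 ev1; rewrite evE ltxx.
  apply/eigenvalues_atP; rewrite compE ?lt_eqF //.
  have trueF m : m \in s -> (ev true m == ev false lam) = false.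
    move=> ms; apply/lt_eqF; rewrite /avg_eigenvalue expr0 expr1.
    have := sqrtr_ge0 m; have : 0 < Num.sqrt lam by rewrite sqrtr_gt0.
    lra.
  have falseE m : m \in s -> (ev false m == ev false lam) = (m == lam).
    move=> ms; have [/andP[m0 _] _ _ _] := sP ms.
    apply/eqP/eqP => [|-> //]; rewrite /avg_eigenvalue expr0 !mul1r => evE.
    have /eqP : Num.sqrt m = Num.sqrt lam by lra.
    by rewrite eqr_sqrt ?(ltW lam0) // => /eqP.
  rewrite (eq_big_seq (fun m => if m == lam then e false m else 0)); last first.
    by move=> m ms; rewrite trueF // falseE // addr0.
  rewrite (bigD1_seq lam) //= eqxx big1 ?addr0 => [|m /negbTE -> //].
  have [/andP[l0 _] uC u0 lE] := sP lams.
  have : 0 < ip (e false lam) (u lam).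
    by rewrite (avg_eigenvector_ip l0 uC lE) mulr_gt0 ?ip_gt0.
  by apply: contraTneq => ->; rewrite ip0l ltxx.
move=> l [/eigenvalues_atP le0 l01].
have l1 : l != 1 by apply: contra_notN l01 => /eqP ->; right.
rewrite compE // in le0; rewrite leNgt; apply: contraNN le0 => ls.
rewrite big_seq big1 // => m ms.
have F b : (ev b m == l) = false.
  apply/lt_eqF; apply: le_lt_trans ls.
  by have /andP[] := avg_eigenvalue_max b ms.
by rewrite !F addr0.
Qed.

End Sequences.

(** * The theorem *)

Unset Implicit Arguments.
Theorem theorem4p6 (R : realType) (d : nat) (ip : {dot 'rV[R]_d for idfun})
    (A B : {vspace 'rV[R]_d}) (a0 x0 : 'rV[R]_d) :
  A != 0%VS -> A != fullv -> B != 0%VS -> B != fullv ->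
  a0 = x0 -> (x0 \in A) || (x0 \in B) ->
  let PA := orth_proj ip A in
  let PB := orth_proj ip B in
  let PAB := orth_proj ip (A :&: B)%VS in
  let S : 'End('rV[R]_d) := 2^-1 *: (PA + PB) in
  let a := fun k : nat => iter k (PA \o PB)%VF a0 in
  let x := fun k : nat => iter k S x0 in
  0 < ipnorm ip (a 1%N - PAB a0) ->
  (forall k : nat, (1 <= k)%N ->
     ipnorm ip (a k - PAB a0) < ipnorm ip (x k - PAB x0) /\
     0 < ipnorm ip (a k - PAB a0)) /\
  exists lambda mu : R,
    [/\ (fun k : nat => ipnorm ip (a k.+1 - PAB a0) / ipnorm ip (a k - PAB a0))
          @ \oo --> lambda,
        is_max (eigenvalues_at ip a0 (PB \o PA \o PB)%VF `\` [set 0; 1]) lambda,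
        (fun k : nat => ipnorm ip (x k.+1 - PAB x0) / ipnorm ip (x k - PAB x0))
          @ \oo --> mu,
        is_max (eigenvalues_at ip x0 S `\` [set 0; 1]) mu &
        mu = 2^-1 + 2^-1 * Num.sqrt lambda /\ lambda < mu].
Proof.
move=> _ _ _ _ -> x0AB PA PB PAB S a x.
have [C [D [CD x0C]]] :
    exists C D, ((C = A /\ D = B) \/ (C = B /\ D = A)) /\ x0 \in C.
  case/orP: x0AB => x0M; first by exists A, B; split=> //; left.
  by exists B, A; split=> //; right.
set p := PAB x0; pose y := x0 - p.
have pAB : p \in (A :&: B)%VS by exact: orth_proj_mem.
have CDAB : (C :&: D = A :&: B)%VS by case: CD => -[-> ->] //; rewrite capvC.
have [pA pB] : p \in A /\ p \in B by apply/andP; rewrite -memv_cap.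
have yC : y \in C.
  by rewrite rpredB //; case: CD => -[-> _].
have yCD : {in (C :&: D)%VS, forall z, ip z y = 0}.
  by move=> z; rewrite CDAB => /(orth_proj_perp ip x0) zE; rewrite ipC ipBl zE subrr.
have [s [u [us yE uo sP]]] := principal_decomposition yC yCD.
have PAp : PA p = p by exact: orth_proj_id.
have PBp : PB p = p by exact: orth_proj_id.
have PABp : (PA \o PB)%VF p = p by rewrite comp_lfunE PBp PAp.
have Tp : (PB \o PA \o PB)%VF p = p by rewrite !comp_lfunE PBp PAp PBp.
have Sp : S p = p.
  rewrite scale_lfunE add_lfunE PAp PBp -mulr2n -(scaler_nat 2 p).
  by rewrite scalerA mulVf ?scale1r ?pnatr_eq0.
have x0E : x0 = y + p by rewrite subrK.
have aE k : a k - p = iter k (PA \o PB)%VF y.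
  by rewrite /a {1}x0E iter_lfun_fix // addrK.
have xE k : x k - p = iter k S y by rewrite /x {1}x0E iter_lfun_fix // addrK.
rewrite aE /ipnorm sqrtr_gt0 yE (alternating_sqnorm CD us sP) => a1.
have s0 : s != [::] by apply: contraTneq a1 => ->; rewrite big_nil ltxx.
have [lam lams lam_max] := seq_max s0.
(* if the largest eigenvalue were 0, the first iterate would be [p] *)
have lam0 : 0 < lam.
  have [/andP[l0 _] _ _ _] := sP _ lams; rewrite lt_neqAle l0 andbT.
  apply: contraTneq a1 => lamE; rewrite big_seq big1 ?ltxx // => l ls.
  have [/andP[l00 _] _ _ _] := sP _ ls.
  suff -> : l = 0 by rewrite expr1 mul0r.
  by apply/le_anti; rewrite l00 lamE lam_max.
have lam1 : lam < 1 by have [/andP[]] := sP _ lams.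
rewrite x0E yE; split.
  move=> [//|j] _; rewrite aE xE yE.
  have gt0 := alternating_sqnorm_gt0 CD us sP lams lam0 j.
  have lt_ax := avg_sqnorm_gt CD us uo sP j s0.
  by rewrite ltr_sqrt ?sqrtr_gt0 // (lt_trans gt0 lt_ax).
exists lam, (avg_eigenvalue false lam); split.
- under eq_fun do rewrite !aE yE.
  exact: (alternating_rate CD us sP lams lam_max lam0).
- exact: (alternating_max_eigenvalue CD us sP Tp lams lam_max lam0).
- under eq_fun do rewrite !xE yE.
  exact: (avg_rate CD us uo sP lams lam_max).
- exact: (avg_max_eigenvalue CD us sP Sp lams lam_max lam0).
split; first by rewrite /avg_eigenvalue expr0 mul1r mulrDr mulr1.
have := sqr_sqrtr (ltW lam0); have := sqrtr_ge0 lam; rewrite /avg_eigenvalue expr0.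
have : Num.sqrt lam < 1 by rewrite -[ltRHS]sqrtr1 ltr_sqrt.
by nra.
Qed.
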